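(* Let $f$ be a Bernstein function with Lévy--Khintchine representation $f(z)=a+bz+\int_0^\infty(1-e^{-tz})\,\mathrm{d}\mu(t)$, and let $A\in\mathbb{C}^{n\times n}$ be Hermitian positive definite with smallest and largest eigenvalue $\lambda_{\min}$ and $\lambda_{\max}$, respectively. Denote by $d(i,j)$ the geodesic distance of the nodes $i$ and $j$ in the graph of $A$ and let $\rho:=(\lambda_{\max}-\lambda_{\min})/4$. Then for all $i,j$ with $d(i,j)\ge 2$, $$ \begin{aligned} |[f(A)]_{ij}|\le{}& 10\int_0^{\frac{d(i,j)}{2\rho}}\frac{\exp(-(\rho+\lambda_{\min})t)}{\rho t}\left(\frac{e\rho t}{d(i,j)}\right)^{d(i,j)}\mathrm{d}\mu(t)\\ &+10\int_{\frac{d(i,j)}{2\rho}}^{\frac{d(i,j)^2}{4\rho}}\exp(-t\lambda_{\min})\exp\left(-\frac{d(i,j)^2}{5\rho t}\right)\mathrm{d}\mu(t) +\int_{\frac{d(i,j)^2}{4\rho}}^\infty\exp(-t\lambda_{\min})\,\mathrm{d}\mu(t). \end{aligned} $$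
   Context: A Bernstein function is a nonnegative, infinitely differentiable function $f:(0,\infty)\to\mathbb{R}$ with $(-1)^{n-1}f^{(n)}(z)\ge 0$ for all $n\in\mathbb{N}=\{1,2,\dots\}$ and $z>0$. Every Bernstein function has a Lévy--Khintchine representation $f(z)=a+bz+\int_0^\infty(1-e^{-tz})\,\mathrm{d}\mu(t)$ with $a,b\ge 0$ and $\mu$ a positive measure on $(0,\infty)$ satisfying $\int_0^\infty\min\{t,1\}\,\mathrm{d}\mu(t)<\infty$. For Hermitian $A=V\Lambda V^H$ with $V$ unitary and $\Lambda=\operatorname{diag}(\lambda_1,\dots,\lambda_n)$, set $f(A)=V\operatorname{diag}(f(\lambda_1),\dots,f(\lambda_n))V^H$. The graph of $A=(a_{ij})$ has nodes $1,\dots,n$ and edges $\{(i,j): a_{ij}\ne 0,\ i\ne j\}$. The geodesic distance $d(i,j)$ is the length of a shortest path from $i$ to $j$ in this graph, with $d(i,j)=\infty$ if no path exists. *)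

(* Defs.v *)
From HB Require Import structures.
From mathcomp Require Import all_boot all_order all_algebra.
From mathcomp Require Import all_classical all_reals all_analysis.
From mathcomp Require Import complex.

Set Implicit Arguments.
Unset Strict Implicit.
Unset Printing Implicit Defensive.

Import Order.TTheory GRing.Theory Num.Theory.
Import numFieldNormedType.Exports.
Export ComplexField.Normc(normc).

Local Open Scope classical_set_scope.
Local Open Scope sesquilinear_scope.
Local Open Scope complex_scope.
Local Open Scope ring_scope.

(* Functions on (0,oo) are given by total functions on R, and measures on
   (0,oo) by Borel measures on R; the values of f on ]-oo,0] and the part of mu
   outside ]0,+oo[ are never used. *)

Definition bernstein (R : realType) (f : R -> R) : Prop :=
  [/\ forall z, 0 < z -> 0 <= f z,
      forall (n : nat) z, 0 < z -> derivable (f^`(n)%classic) z 1 &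
      forall (n : nat) z, (0 < n)%N -> 0 < z -> 0 <= (-1) ^+ n.-1 * f^`(n)%classic z].

Definition levy_khintchine (R : realType) (f : R -> R) (a b : R)
    (mu : {measure set (measurableTypeR R) -> \bar R}) : Prop :=
  [/\ 0 <= a, 0 <= b,
      (\int[mu]_(t in `]0%R, +oo[) (Num.min t 1)%:E < +oo)%E &
      forall z, 0 < z ->
        (f z)%:E = ((a + b * z)%:E +
                    \int[mu]_(t in `]0%R, +oo[) (1 - expR (- (t * z)))%:E)%E].

Definition posdefmx (R : realType) (n : nat) (A : 'M[R[i]]_n) : Prop :=
  A \is hermsymmx /\
  forall v : 'cV[R[i]]_n, v != 0 -> 0 < (v ^t* *m A *m v) ord0 ord0.

(* In the order of R[i], x <= y means Im x = Im y and Re x <= Re y. *)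
Definition smallest_eigenvalue (R : realType) (n : nat) (A : 'M[R[i]]_n)
    (l : R) : Prop :=
  eigenvalue A l%:C /\ forall x : R[i], eigenvalue A x -> l%:C <= x.

Definition largest_eigenvalue (R : realType) (n : nat) (A : 'M[R[i]]_n)
    (l : R) : Prop :=
  eigenvalue A l%:C /\ forall x : R[i], eigenvalue A x -> x <= l%:C.

(* V f(Lambda) V^H for MathComp's choice A = V Lambda V^H with
   V^H = spectralmx A, Lambda = spectral_diag A; the eigenvalues of a Hermitian
   matrix are real, so 'Re' discards nothing.  hermfunE shows that every other
   unitary diagonalization gives the same matrix. *)
Definition hermfun (R : realType) (n : nat) (f : R -> R) (A : 'M[R[i]]_n) :
    'M[R[i]]_n :=
  (spectralmx A) ^t* *m
    diag_mx (\row_k (f (complex.Re (spectral_diag A 0 k)))%:C) *m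
    spectralmx A.

Lemma hermfunE (R : realType) (n : nat) (f : R -> R) (A V : 'M[R[i]]_n)
    (lam : 'rV[R]_n) :
  V \is unitarymx ->
  A = V *m diag_mx (map_mx (real_complex R) lam) *m V ^t* ->
  hermfun f A = V *m diag_mx (\row_k (f (lam 0 k))%:C) *m V ^t*.
Proof.
move=> Vu AE.
have VVs : V *m V ^t* = 1%:M by apply/unitarymxP.
have VsV : V ^t* *m V = 1%:M by apply: mulmx1C.
have An : A \is normalmx.
  apply/orthomx_spectral_subproof; exists (V ^t*, map_mx (real_complex R) lam).
    by rewrite /= trmxC_unitary.
  by rewrite /= invmx_unitary ?trmxC_unitary // trmxCK -AE.
move/orthomx_spectralP: An => AS.
have Pu := spectral_unitarymx A.
rewrite /hermfun; move: (spectralmx A) (spectral_diag A) Pu AS => P D Pu AS.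
have PPs : P *m P ^t* = 1%:M by apply/unitarymxP.
have PsP : P ^t* *m P = 1%:M by apply: mulmx1C.
rewrite invmx_unitary // in AS.
set L := diag_mx (map_mx _ lam) in AE.
have comm : diag_mx D *m (P *m V) = (P *m V) *m L.
  have : P *m (P ^t* *m diag_mx D *m P) *m V = P *m (V *m L *m V ^t*) *m V.
    by rewrite -AE -AS.
  by rewrite !mulmxA PPs mul1mx -!mulmxA VsV mulmx1 !mulmxA.
set FD := diag_mx _; set FL := (X in _ = V *m X *m _).
have {}comm : FD *m (P *m V) = (P *m V) *m FL.
  apply/matrixP => i j; move/matrixP/(_ i j): comm.
  rewrite /L /FD /FL !mul_diag_mx !mul_mx_diag !mxE.
  move: (\sum_k _) => u.
  have [->|u0] := eqVneq u 0; first by rewrite !mulr0 !mul0r.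
  by rewrite [LHS]mulrC => /(mulfI u0) ->; rewrite mulrC.
have : P ^t* *m (FD *m (P *m V)) *m V ^t* = P ^t* *m ((P *m V) *m FL) *m V ^t*.
  by rewrite comm.
by rewrite !mulmxA PsP mul1mx -!mulmxA VVs mulmx1.
Qed.

Definition mxgraph (R : realType) (n : nat) (A : 'M[R[i]]_n) : rel 'I_n :=
  [rel i j | (i != j) && (A i j != 0)].

Definition has_walk (T : finType) (e : rel T) (i j : T) (k : nat) : bool :=
  [exists p : k.-tuple T, path e i p && (last i p == j)].

(* None stands for the distance oo. *)
Definition geodist (T : finType) (e : rel T) (i j : T) : option nat :=
  if pselect (exists k, has_walk e i j k) is left ex then Some (ex_minn ex)
  else None.

Definition dist_geq (m : nat) (d : option nat) : bool :=
  if d is Some k then (m <= k)%N else true.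

(* Main.v *)
Require Import Defs.
From HB Require Import structures.
From mathcomp Require Import all_boot all_order all_algebra.
From mathcomp Require Import all_classical all_reals all_analysis.
From mathcomp Require Import measurable_realfun.
From mathcomp Require Import complex ring lra.

(** Write [f(A)_ij = sum_k w_k f(lam_k)] with the complex weights
    [w_k = V_ik conj(V_jk)].  Rotating by the phase of [f(A)_ij] turns them into
    real weights [r_k] with [sum |r_k| <= 1], and all moments
    [sum r_k lam_k^l] with [l < d(i,j)] vanish since [(A^l)_ij = 0].  Hence
    [|f(A)_ij|] is at most the integral of [|sum_k r_k exp (- t lam_k)|] against
    the Levy measure, and it suffices to bound this exponential sum.

    Put [lam_k = lmin + 2 rho (1 + cos phi_k)].  The sums of
    [r_k cos (m phi_k)] vanish for [m < d] and are at most [1], so for every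
    [z >= 1] they are at most [z^-d (z^m + z^-m)], which is an eigenvector of the
    recursion [2 cos phi cos (m phi) = cos ((m+1) phi) + cos ((m-1) phi)] for
    the value [z + z^-1].  Therefore
    [|sum r_k cos(phi_k)^n| <= 2 z^-d ((z + z^-1) / 2)^n], and summing the
    exponential series gives
    [|sum r_k exp (- t lam_k)| <= 2 z^-d exp (rho t (z + z^-1 - 2) - t lmin)].
    This is a Chernoff bound for the simple random walk; [z = d / (rho t)] gives
    the first range of integration and [z = exp (d / (2 rho t))] the second. *)

Set Implicit Arguments.
Unset Strict Implicit.
Unset Printing Implicit Defensive.

Import Order.TTheory GRing.Theory Num.Theory.
Import numFieldNormedType.Exports.

Local Open Scope classical_set_scope.
Local Open Scope sesquilinear_scope.
Local Open Scope complex_scope.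
Local Open Scope ring_scope.

(** * Sums with vanishing moments *)

Section VanishingMoments.
Variables (R : realType) (I : finType) (r : I -> R).

(** [cos (m phi)] is a polynomial of degree [m] in [cos phi]. The spare power [l] lets the Chebyshev
    recursion in [m] close under induction. *)
Lemma cos_moment0 (phi : I -> R) (d : nat) :
  (forall l, (l < d)%N -> \sum_k r k * cos (phi k) ^+ l = 0) ->
  forall m l, (m + l < d)%N ->
    \sum_k r k * (cos (m%:R * phi k) * cos (phi k) ^+ l) = 0.
Proof.
move=> H m; elim/ltn_ind: m => -[_ l hl|[_ l hl|m IH l hl]].
- by under eq_bigr do rewrite mul0r cos0 mul1r; apply: H.
- by under eq_bigr do rewrite mul1r -exprS; apply: H.
transitivity (2 * \sum_k r k * (cos (m.+1%:R * phi k) * cos (phi k) ^+ l.+1)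
    - \sum_k r k * (cos (m%:R * phi k) * cos (phi k) ^+ l)); last first.
  rewrite !IH ?mulr0 ?subr0 //; last by rewrite addnS.
  by apply: leq_trans hl; rewrite ltnS leq_add2r leqW.
rewrite mulr_sumr -sumrB; apply: eq_bigr => k _.
have -> : m.+2%:R * phi k = m.+1%:R * phi k + phi k.
  by rewrite -[in LHS]addn1 natrD mulrDl mul1r.
have -> : m%:R * phi k = m.+1%:R * phi k - phi k.
  by rewrite -[in RHS]addn1 natrD mulrDl mul1r addrK.
by rewrite cosD cosB exprS; ring.
Qed.

Lemma cos_moment_bound (phi : I -> R) (d : nat) (z : R) :
  1 <= z -> \sum_k `|r k| <= 1 ->
  (forall l, (l < d)%N -> \sum_k r k * cos (phi k) ^+ l = 0) ->
  forall n m,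
    `|\sum_k r k * (cos (m%:R * phi k) * cos (phi k) ^+ n)|
      <= ((z + z^-1) / 2) ^+ n * (z ^- d * (z ^+ m + z ^- m)).
Proof.
move=> z1 r1 H; have z0 : 0 < z by exact: lt_le_trans z1.
elim=> [m|n IH [|m]].
- under eq_bigr do rewrite expr0 mulr1.
  (* Below [d] the sum is zero; from [d] on, the trivial bound 1 is at most [z^(m - d)]. *)
  rewrite expr0 mul1r; have [md|dm] := ltnP m d.
    have := cos_moment0 H (l := 0) (m := m); rewrite addn0 => /(_ md) H0.
    rewrite (eq_bigr (fun k => r k * (cos (m%:R * phi k) * cos (phi k) ^+ 0))) ?H0.
      by rewrite normr0 mulr_ge0 ?addr_ge0 ?invr_ge0 ?exprn_ge0 // ltW.
    by move=> k _; rewrite expr0 mulr1.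
  apply: (@le_trans _ _ 1).
    apply: le_trans (ler_norm_sum _ _ _) _; apply: le_trans r1.
    by apply: ler_sum => k _; rewrite normrM ler_piMr // ler_norml cos_geN1 cos_le1.
  rewrite mulrDr -[leLHS]addr0 lerD //.
    by rewrite mulrC ler_pdivlMr ?exprn_gt0 // mul1r ler_weXn2l.
  by rewrite mulr_ge0 ?invr_ge0 ?exprn_ge0 // ltW.
(* At [m = 0] one factor [cos phi] is read as frequency 1; since [z^0 + z^-0 = 2], the two bounds
   agree exactly. *)
- rewrite (eq_bigr (fun k => r k * (cos (1%:R * phi k) * cos (phi k) ^+ n))).
    apply: le_trans (IH 1%N) _.
    rewrite expr1 [in leRHS]exprSr !expr0 invr1 le_eqVlt; apply/predU1P; left.
    by field; rewrite expf_neq0 ?gt_eqF.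
  by move=> k _; rewrite mul1r mul0r cos0 mul1r exprS.
have -> : \sum_k r k * (cos (m.+1%:R * phi k) * cos (phi k) ^+ n.+1) =
  2^-1 * (\sum_k r k * (cos (m.+2%:R * phi k) * cos (phi k) ^+ n) +
          \sum_k r k * (cos (m%:R * phi k) * cos (phi k) ^+ n)).
  rewrite -big_split mulr_sumr; apply: eq_bigr => k _ /=.
  have -> : m.+2%:R * phi k = m.+1%:R * phi k + phi k.
    by rewrite -[in LHS]addn1 natrD mulrDl mul1r.
  have -> : m%:R * phi k = m.+1%:R * phi k - phi k.
    by rewrite -[in RHS]addn1 natrD mulrDl mul1r addrK.
  by rewrite cosD cosB exprS; field.
rewrite normrM ger0_norm ?invr_ge0 //.
apply: (@le_trans _ _ (2^-1 *
  (((z + z^-1) / 2) ^+ n * (z ^- d * (z ^+ m.+2 + z ^- m.+2)) +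
   ((z + z^-1) / 2) ^+ n * (z ^- d * (z ^+ m + z ^- m))))).
  by rewrite ler_wpM2l ?invr_ge0 // (le_trans (ler_normD _ _)) // lerD.
rewrite le_eqVlt; apply/predU1P; left.
rewrite [in RHS]exprS; set q := (_ / 2) ^+ n; rewrite !(exprS z).
by field; rewrite ?expf_neq0 ?gt_eqF.
Qed.

Lemma moment_bound (y : I -> R) (d : nat) (z : R) :
  1 <= z -> \sum_k `|r k| <= 1 -> (forall k, -1 <= y k <= 1) ->
  (forall l, (l < d)%N -> \sum_k r k * y k ^+ l = 0) ->
  forall n, `|\sum_k r k * y k ^+ n| <= 2 * z ^- d * ((z + z^-1) / 2) ^+ n.
Proof.
move=> z1 r1 y1 H n.
have yE k : cos (acos (y k)) = y k by rewrite acosK // in_itv /= y1.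
have := @cos_moment_bound (acos \o y) d z z1 r1 _ n 0%N.
under eq_bigr do rewrite mul0r cos0 mul1r /= yE.
rewrite expr0 invr1 => /(_ _) /le_trans; apply.
  by move=> l ld; under eq_bigr do rewrite /= yE; apply: H.
by rewrite le_eqVlt; apply/predU1P; left; ring.
Qed.

(** The exponential series is bounded term by term; its weighted partial sums stay below [C] times
    those of [expR q], which increase to the limit. *)
Lemma expR_sum_bound (x : I -> R) (C q : R) :
  0 <= q ->
  (forall n, `|\sum_k r k * x k ^+ n| <= C * q ^+ n) ->
  `|\sum_k r k * expR (x k)| <= C * expR q.
Proof.
move=> q0 H.
have C0 : 0 <= C by have := H 0%N; rewrite expr0 mulr1; apply: le_trans.
have cv : (\sum_k r k * series (exp_coeff (x k)) n) @[n --> \oo] -->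
    \sum_k r k * expR (x k).
  elim: (index_enum I) => [|k s IH].
    by rewrite big_nil; under eq_cvg do rewrite big_nil; exact: cvg_cst.
  rewrite big_cons; under eq_cvg do rewrite big_cons.
  by apply: cvgD => //; apply: cvgMr; exact: is_cvg_series_exp_coeff.
apply: (cvgr_to_le (cvg_norm cv)); near=> N.
apply: (@le_trans _ _ (C * series (exp_coeff q) N)); last first.
  rewrite ler_wpM2l //; apply: nondecreasing_cvgn_le.
    apply/nondecreasing_seqP => k; rewrite /series /= big_nat_recr //= lerDl.
    exact: exp_coeff_ge0.
  exact: is_cvg_series_exp_coeff.
rewrite /series /=; under eq_bigr do rewrite mulr_sumr.
rewrite exchange_big /= mulr_sumr; apply: le_trans (ler_norm_sum _ _ _) _.
apply: ler_sum => m _; rewrite /exp_coeff /=.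
under eq_bigr do rewrite mulrA.
by rewrite -mulr_suml normrM (ger0_norm (x := _^-1)) ?invr_ge0 ?ler0n //
  mulrA ler_wpM2r ?invr_ge0.
Unshelve. all: by end_near. Qed.

End VanishingMoments.

(** Gives a geometric majorant of ratio 1/2 for the exponential series from order four on. *)
Lemma fact_geM24 (n : nat) : (24 * 2 ^ n <= (n + 4)`!)%N.
Proof.
elim: n => // n IH; rewrite addSn factS expnS mulnCA leq_mul //.
by rewrite addnS.
Qed.

(* The exponent [- d^2 / (5 rho t)] of the second range needs exactly the constant
   [6 / 5 = 2 - 4 / 5], which exceeds [2 cosh 1 - 2 = 1.086...]. *)
Lemma expRDN_le (R : realType) (x : R) :
  0 <= x <= 1 -> expR x + expR (- x) <= 2 + 6 / 5 * x ^+ 2.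
Proof.
move=> /andP[x0 x1].
have cv := cvgD (@is_cvg_series_exp_coeff R x) (@is_cvg_series_exp_coeff R (- x)).
apply: (cvgr_to_le (cv _)).
exists 4%N => // n /= n4; rewrite -(subnK n4).
(* Orders 0 to 3 contribute exactly [2 + x^2]. Order [n + 4] adds at most [x^2 / 12 * 2^-n], so the
   tail is at most [x^2 / 6], and [7 / 6 <= 6 / 5]. *)
have : series (exp_coeff x) (n - 4 + 4)%N + series (exp_coeff (- x)) (n - 4 + 4)%N <=
   2 + x ^+ 2 + x ^+ 2 / 6 * (1 - 2 ^- (n - 4)).
  move: (n - 4)%N => {n n4}; elim => [|n IH].
    rewrite add0n expr0 invr1 subrr mulr0 addr0 /series /= !big_nat_recr //= !big_nil.
    rewrite /exp_coeff /= !expr1 !expr0 /= !factS fact0 /=.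
    by rewrite le_eqVlt; apply/predU1P; left; field.
  rewrite addSn /series /= big_nat_recr //= [X in _ + X <= _]big_nat_recr //= addrACA.
  have : exp_coeff x (n + 4)%N + exp_coeff (- x) (n + 4)%N <= x ^+ 2 / 12 * 2 ^- n.
    rewrite /exp_coeff /= -mulrDl.
    have h1 : x ^+ (n + 4) <= x ^+ 2.
      by apply: ler_wiXn2l => //; rewrite addnS addnS ltnS.
    have h2 : (- x) ^+ (n + 4) <= x ^+ 2.
      by apply: le_trans h1; rewrite (le_trans (ler_norm _)) // normrX normrN ger0_norm.
    have h3 : ((n + 4)`!%:R)^-1 <= (24 * 2 ^+ n)^-1 :> R.
      rewrite lef_pV2 ?posrE ?ltr0n ?fact_gt0 ?mulr_gt0 ?exprn_gt0 //.
      by rewrite -natrX -natrM ler_nat fact_geM24.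
    have h4 : 0 <= ((n + 4)`!%:R)^-1 :> R by rewrite invr_ge0.
    apply: (@le_trans _ _ ((2 * x ^+ 2) * (n + 4)`!%:R^-1)).
      by rewrite ler_wpM2r //; lra.
    apply: (@le_trans _ _ ((2 * x ^+ 2) * (24 * 2 ^+ n)^-1)).
      by rewrite ler_wpM2l // mulr_ge0 ?sqr_ge0.
    by rewrite invfM; lra.
  move=> h; apply: le_trans (lerD IH h) _.
  by rewrite (exprS 2 n) invfM; lra.
move=> /le_trans; apply.
have : 0 <= x ^+ 2 / 6 * 2 ^- (n - 4) by rewrite !mulr_ge0 ?invr_ge0 ?exprn_ge0 ?sqr_ge0.
have := sqr_ge0 x; lra.
Qed.

(** * Bounds for the exponential sum on the three ranges of integration *)

Section ExpSum.
Variables (R : realType) (I : finType) (r lam : I -> R).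

Lemma affine_moment0 (d : nat) (u v : R) :
  (forall l, (l < d)%N -> \sum_k r k * lam k ^+ l = 0) ->
  forall l, (l < d)%N -> \sum_k r k * (u * lam k + v) ^+ l = 0.
Proof.
move=> H l ld.
under eq_bigr do rewrite exprDn mulr_sumr.
rewrite exchange_big big1 //= => m _.
rewrite (eq_bigr (fun k => (u ^+ (l - m) * (v ^+ m *+ 'C(l, m))) *
    (r k * lam k ^+ (l - m)))); last first.
  move=> k _; rewrite exprMn -mulrnAr.
  move: (u ^+ _) (lam k ^+ _) (_ *+ _) (r k) => p1 p2 p3 p4; ring.
by rewrite -mulr_sumr H ?mulr0 // (leq_ltn_trans (leq_subr _ _)).
Qed.

Lemma exp_sum_bound (d : nat) (lmin rho t z : R) :
  0 < rho -> 0 <= t -> 1 <= z -> \sum_k `|r k| <= 1 ->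
  (forall k, lmin <= lam k <= lmin + 4 * rho) ->
  (forall l, (l < d)%N -> \sum_k r k * lam k ^+ l = 0) ->
  `|\sum_k r k * expR (- (t * lam k))| <=
    2 * z ^- d * expR (rho * t * (z + z^-1 - 2) - t * lmin).
Proof.
move=> rho0 t0 z1 r1 lamb H; have z0 : 0 < z by exact: lt_le_trans z1.
(* The affine map from [[lmin, lmin + 4 rho]] onto [[-1, 1]], so that
   [t lam_k = t (lmin + 2 rho) + 2 rho t y_k]. *)
pose y k := (2 * rho)^-1 * lam k + - (lmin / (2 * rho) + 1).
have yb k : -1 <= y k <= 1.
  have -> : y k = (lam k - (lmin + 2 * rho)) / (2 * rho) by rewrite /y; field; lra.
  by rewrite ler_pdivlMr ?ler_pdivrMr ?mulr_gt0 //; have := lamb k; lra.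
have ybound := moment_bound z1 r1 yb (affine_moment0 _ _ H).
have s0 : 0 <= 2 * rho * t by rewrite !mulr_ge0 // ltW.
have q0 : 0 <= (z + z^-1) / 2 by rewrite divr_ge0 // addr_ge0 ?invr_ge0 // ltW.
have := @expR_sum_bound R I r (fun k => - (2 * rho * t) * y k) (2 * z ^- d)
  (2 * rho * t * ((z + z^-1) / 2)) (mulr_ge0 s0 q0).
have bd n : `|\sum_k r k * (- (2 * rho * t) * y k) ^+ n| <=
   2 * z ^- d * (2 * rho * t * ((z + z^-1) / 2)) ^+ n.
  move: (2 * rho * t) s0 => s s0.
  under eq_bigr do rewrite exprMn mulrCA.
  rewrite -mulr_sumr normrM normrX normrN (ger0_norm s0) exprMn mulrCA.
  by rewrite ler_wpM2l ?exprn_ge0.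
move=> /(_ bd) {}bd.
have E k : expR (- (t * lam k)) =
    expR (- (t * (lmin + 2 * rho))) * expR (- (2 * rho * t) * y k).
  by rewrite -expRD; congr expR; rewrite /y; field; lra.
under eq_bigr do rewrite E mulrCA.
rewrite -mulr_sumr normrM (ger0_norm (expR_ge0 _)).
apply: le_trans (ler_wpM2l (expR_ge0 _) bd) _.
rewrite mulrCA -expRD le_eqVlt; apply/predU1P; left.
by congr (_ * expR _); field; rewrite gt_eqF.
Qed.

Lemma exp_sum_trivial_bound (lmin t : R) :
  0 <= t -> \sum_k `|r k| <= 1 -> (forall k, lmin <= lam k) ->
  `|\sum_k r k * expR (- (t * lam k))| <= expR (- (t * lmin)).
Proof.
move=> t0 r1 H; apply: le_trans (ler_norm_sum _ _ _) _.
rewrite -[leRHS]mul1r; apply: le_trans (ler_wpM2r (expR_ge0 _) r1).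
rewrite mulr_suml; apply: ler_sum => k _.
rewrite normrM (ger0_norm (expR_ge0 _)) ler_wpM2l // ler_expR lerN2.
by rewrite ler_wpM2l.
Qed.

Lemma exp_sum_bound_small (d : nat) (lmin rho t : R) :
  0 < rho -> (0 < d)%N -> 0 < t -> t <= d%:R / (2 * rho) ->
  \sum_k `|r k| <= 1 -> (forall k, lmin <= lam k <= lmin + 4 * rho) ->
  (forall l, (l < d)%N -> \sum_k r k * lam k ^+ l = 0) ->
  `|\sum_k r k * expR (- (t * lam k))| <=
    10 * (expR (- ((rho + lmin) * t)) / (rho * t) *
              (expR 1 * rho * t / d%:R) ^+ d).
Proof.
move=> rho0 d0 t0 td r1 lamb H.
have dR0 : 0 < d%:R :> R by rewrite ltr0n.
have rt0 : 0 < rho * t by rewrite mulr_gt0.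
have rtd : 2 * (rho * t) <= d%:R.
  by move: td; rewrite ler_pdivlMr ?mulr_gt0 //; lra.
have z1 : 1 <= d%:R / (rho * t) by rewrite ler_pdivlMr //; lra.
apply: le_trans (exp_sum_bound rho0 (ltW t0) z1 r1 lamb H) _.
set X := rho * t in rt0 rtd z1 *.
have -> : expR 1 * rho * t / d%:R = expR 1 * (X / d%:R) by rewrite /X; ring.
rewrite -exprVn invf_div [(expR 1 * _) ^+ _]exprMn -expRM_natl mulr1.
set w := X / d%:R.
have wd0 : 0 <= w ^+ d by rewrite exprn_ge0 // divr_ge0 ?ltW.
(* With [z = 1 / w] the exponent is [d + X w - 2 X - t lmin]; [w <= 1 / 2] leaves a spare factor
   [expR (- (X / 2))]. *)
have e1 : expR (X * (d%:R / X + w - 2) - t * lmin) <=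
    expR d%:R * expR (- ((rho + lmin) * t)) * expR (- (X / 2)).
  rewrite -!expRD ler_expR.
  have -> : X * (d%:R / X + w - 2) = d%:R + X * w - 2 * X by field; rewrite gt_eqF.
  have : X * w <= X * (1 / 2).
    by rewrite ler_wpM2l ?(ltW rt0) // /w ler_pdivrMr //; lra.
  by rewrite /X; lra.
(* The spare factor supplies the denominator [rho t]; the 5 makes the total constant
   [2 * 5 = 10]. *)
have e2 : expR (- (X / 2)) <= 5 / X.
  rewrite expRN -[leRHS]invf_div lef_pV2 ?posrE ?expR_gt0 ?divr_gt0 //.
  by apply: le_trans (expR_ge1Dx _); lra.
have e3 : 0 <= expR d%:R * expR (- ((rho + lmin) * t)) :> R by rewrite mulr_ge0 ?expR_ge0.
apply: (@le_trans _ _ (2 * w ^+ d * (expR d%:R * expR (- ((rho + lmin) * t)) * (5 / X)))).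
  by rewrite ler_wpM2l ?mulr_ge0 // (le_trans e1) // ler_wpM2l.
by rewrite le_eqVlt; apply/predU1P; left; ring.
Qed.

Lemma exp_sum_bound_mid (d : nat) (lmin rho t : R) :
  0 < rho -> (0 < d)%N -> d%:R / (2 * rho) < t ->
  \sum_k `|r k| <= 1 -> (forall k, lmin <= lam k <= lmin + 4 * rho) ->
  (forall l, (l < d)%N -> \sum_k r k * lam k ^+ l = 0) ->
  `|\sum_k r k * expR (- (t * lam k))| <=
    10 * (expR (- (t * lmin)) * expR (- (d%:R ^+ 2 / (5 * rho * t)))).
Proof.
move=> rho0 d0 dt r1 lamb H.
have dR0 : 0 < d%:R :> R by rewrite ltr0n.
have t0 : 0 < t by apply: le_lt_trans dt; rewrite divr_ge0 // mulr_ge0 // ltW.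
have rt0 : 0 < rho * t by rewrite mulr_gt0.
have rtd : d%:R < 2 * (rho * t) by move: dt; rewrite ltr_pdivrMr ?mulr_gt0 //; lra.
(* For [z = expR x], this [x] minimizes the quadratic approximation [rho t x^2 - d x] of the
   exponent; [x <= 1] permits [expRDN_le]. *)
pose x := d%:R / (2 * (rho * t)).
have x0 : 0 <= x by rewrite divr_ge0 // mulr_ge0 // ltW.
have x1 : x <= 1 by rewrite ler_pdivrMr ?mulr_gt0 // mul1r ltW.
have z1 : 1 <= expR x by rewrite -[leLHS]expR0 ler_expR.
apply: le_trans (exp_sum_bound rho0 (ltW t0) z1 r1 lamb H) _.
rewrite -exprVn -!expRN -expRM_natl -mulrA -!expRD.
apply: (@le_trans _ _ (2 * expR (- (t * lmin) - d%:R ^+ 2 / (5 * rho * t)))); last first.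
  by rewrite ler_wpM2r ?expR_ge0 //; lra.
rewrite ler_wpM2l // ler_expR.
have dE : d%:R = 2 * (rho * t) * x by rewrite /x; field; rewrite !gt_eqF.
have -> : d%:R ^+ 2 / (5 * rho * t) = rho * t * (4 / 5 * x ^+ 2).
  by rewrite dE; field; rewrite !gt_eqF.
have : rho * t * (expR x + expR (- x)) <= rho * t * (2 + 6 / 5 * x ^+ 2).
  by rewrite ler_wpM2l ?(ltW rt0) // expRDN_le // x0.
have -> : d%:R * (- x) = - (rho * t * (2 * x ^+ 2)) by rewrite dE; ring.
by lra.
Qed.

End ExpSum.

(** * Integration against the Levy measure *)

Section LevyIntegral.
Variables (R : realType) (mu : {measure set (measurableTypeR R) -> \bar R}).

Lemma measurable_funV_pos (D : set R) (g : R -> R) :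
  measurable_fun D g -> (forall t, D t -> 0 < g t) ->
  measurable_fun D (fun t => (g t)^-1).
Proof.
move=> mg g0; apply: (eq_measurable_fun (fun t => g t `^ (-1))).
  by move=> t /set_mem Dt; rewrite powR_inv1 // ltW ?g0.
exact: (measurableT_comp (measurable_powR (-1)) mg).
Qed.

Lemma measurable_expRN_mulr (D : set R) (c : R) :
  measurable_fun D (fun t => expR (- (t * c))).
Proof.
apply: measurableT_comp => //; apply: measurable_funN.
exact: measurable_funM.
Qed.

Lemma measurable_expRN_mull (D : set R) (c : R) :
  measurable_fun D (fun t => expR (- (c * t))).
Proof.
apply: measurableT_comp => //; apply: measurable_funN.
exact: measurable_funM.
Qed.

(** Moments 0 and 1 cancel the affine part [a + b z], and moment 0 also cancels the 1 in
    [1 - exp (- t z)]. *)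
Lemma levy_sum_le (I : finType) (r lam : I -> R) (f : R -> R) (a b : R) :
  levy_khintchine f a b mu -> (forall k, 0 < lam k) ->
  \sum_k r k = 0 -> \sum_k r k * lam k = 0 ->
  ((\sum_k r k * f (lam k))%:E <=
   \int[mu]_(t in `]0%R, +oo[) `|\sum_k r k * expR (- (t * lam k))|%:E)%E.
Proof.
move=> [_ _ _ fE] lam0 r0 r1.
pose g k t := (1 - expR (- (t * lam k)))%:E.
have mg k : measurable_fun (`]0, +oo[%classic : set R) (g k).
  apply/measurable_EFinP; apply: measurable_funB => //.
  exact: measurable_expRN_mulr.
have g0 k t : (`]0, +oo[%classic : set R) t -> (0 <= g k t)%E.
  rewrite /= in_itv /= andbT => t0.
  by rewrite lee_fin subr_ge0 -expR0 ler_expR oppr_le0 mulr_ge0 ?ltW.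
(* As [f (lam k)] is real, the representation forces this integral to be finite; this gives the
   integrability needed to exchange sum and integral. *)
have JE k : (\int[mu]_(t in `]0%R, +oo[) g k t = (f (lam k) - (a + b * lam k))%:E)%E.
  have := fE _ (lam0 k); rewrite -/(g k); set J := integral _ _ _.
  case: J => [J| |] //= [->]; by rewrite addrAC subrr add0r.
have ig k : mu.-integrable (`]0, +oo[%classic : set R) (g k).
  apply/integrableP; split; first exact: mg.
  under eq_integral => t /set_mem Dt do rewrite gee0_abs ?g0 //.
  by rewrite JE ltry.
have -> : \sum_k r k * f (lam k) = \sum_k r k * (f (lam k) - (a + b * lam k)).
  have E k : r k * (f (lam k) - (a + b * lam k)) =
     r k * f (lam k) - (a * r k + b * (r k * lam k)) by ring.
  under [RHS]eq_bigr do rewrite E.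
  by rewrite sumrB big_split /= -!mulr_sumr r0 r1 !mulr0 addr0 subr0.
rewrite -sumEFin; under eq_bigr do rewrite EFinM -JE -integralZl //.
rewrite -integral_sum //; last by move=> k; exact: integrableZl.
apply: le_trans (lee_abs _) _; apply: le_trans (le_abse_integral _ _ _) _ => //.
  apply: (measurable_int mu); apply: integrable_sum => // k _.
  exact: integrableZl.
rewrite le_eqVlt; apply/predU1P; left; apply: eq_integral => t _.
under eq_bigr do rewrite -EFinM.
rewrite sumEFin /=; congr (_%:E).
under eq_bigr do rewrite mulrBr mulr1.
by rewrite sumrB r0 sub0r normrN.
Qed.

Lemma levy_sum_bound (I : finType) (r lam : I -> R) (f : R -> R) (a b lmin rho : R)
    (d : nat) :
  levy_khintchine f a b mu -> 0 < lmin -> 0 < rho -> (2 <= d)%N ->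
  \sum_k `|r k| <= 1 -> (forall k, lmin <= lam k <= lmin + 4 * rho) ->
  (forall l, (l < d)%N -> \sum_k r k * lam k ^+ l = 0) ->
  ((\sum_k r k * f (lam k))%:E <=
        10%:E * \int[mu]_(t in `]0%R, (d%:R / (2 * rho))%R])
           (expR (- ((rho + lmin) * t)) / (rho * t) *
              (expR 1 * rho * t / d%:R) ^+ d)%:E
        + 10%:E * \int[mu]_(t in `](d%:R / (2 * rho))%R, (d%:R ^+ 2 / (4 * rho))%R])
           (expR (- (t * lmin)) * expR (- (d%:R ^+ 2 / (5 * rho * t))))%:E
        + \int[mu]_(t in `](d%:R ^+ 2 / (4 * rho))%R, +oo[)
           (expR (- (t * lmin)))%:E)%E.
Proof.
move=> fE lmin0 rho0 d2 r1 lamb H.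
have d0 : (0 < d)%N by exact: ltn_trans d2.
have lam_ge k : lmin <= lam k by case/andP: (lamb k).
apply: le_trans (levy_sum_le fE _ _ _) _.
- by move=> k; apply: lt_le_trans (lam_ge k).
- by have := H 0%N d0; under eq_bigr do rewrite expr0 mulr1.
- by have := H 1%N d2; under eq_bigr do rewrite expr1.
set p := d%:R / (2 * rho); set q := d%:R ^+ 2 / (4 * rho).
have p0 : 0 < p by rewrite divr_gt0 ?mulr_gt0 ?ltr0n.
(* [q = (d / 2) p], so [2 <= d] keeps the ranges in order. *)
have pq : p <= q.
  have -> : q = d%:R / 2 * p by rewrite /p /q; field; rewrite gt_eqF.
  by rewrite ler_peMl ?(ltW p0) // ler_pdivlMr // mul1r ler_nat.
set h := fun t : R => `|\sum_k r k * expR (- (t * lam k))|%:E.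
have mh (D : set R) : measurable_fun D (h : R -> _).
  apply/measurable_EFinP; apply: measurableT_comp => //.
  apply: measurable_sum => k; apply: measurable_funM => //.
  exact: measurable_expRN_mulr.
have h0 t : (0 <= h t)%E by rewrite lee_fin.
have disj (x y : itv_bound R) (z : R) :
    [disjoint [set` Interval x (BRight z)] & [set` Interval (BRight z) y]].
  apply: lt_disjoint => u v; rewrite !itv_boundlr => /andP[_ uz] /andP[zv _].
  by move: uz zv; rewrite !bnd_simp; exact: le_lt_trans.
(* Comparison on one range; [k] is 10 on the first two and 1 on the last. *)
have int_pos (i : interval R) (g : R -> R) (k : R) :
    0 <= k ->
    measurable_fun ([set` i] : set R) g ->
    (forall t, t \in i -> 0 <= g t) ->
    (forall t, t \in i -> `|\sum_k r k * expR (- (t * lam k))| <= k * g t) ->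
    (\int[mu]_(t in [set` i]) h t <= k%:E * \int[mu]_(t in [set` i]) (g t)%:E)%E.
  move=> k0 mg g0 hg; rewrite -ge0_integralZl_EFin //.
  - apply: ge0_le_integral; [exact: measurable_itv|by []|exact: mh| |].
      by apply: measurable_funeM; apply/measurable_EFinP.
    by move=> t /hg; rewrite -lee_fin EFinM.
  - exact/measurable_EFinP.
rewrite (@itv_bndbnd_setU _ _ (BRight 0) (BRight q) +oo%O) ?bnd_simp //; last first.
  exact: (le_trans (ltW p0)).
rewrite ge0_integral_setU //=; last exact: mh.
rewrite (@itv_bndbnd_setU _ _ (BRight 0) (BRight p) (BRight q)) ?bnd_simp ?(ltW p0) //.
rewrite ge0_integral_setU //=; last exact: mh.
apply: leeD; first apply: leeD.
- apply: int_pos => // [|t|t].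
  + apply: measurable_funM.
      apply: measurable_funM.
        exact: measurable_expRN_mull.
      apply: measurable_funV_pos; first exact: measurable_funM.
      by move=> t; rewrite /= in_itv => /andP[t0 _]; rewrite mulr_gt0.
    apply: measurable_funX; apply: measurable_funM => //.
  + rewrite in_itv => /andP[t0 _]; have t1 := ltW t0; have rho1 := ltW rho0.
    by rewrite mulr_ge0 ?exprn_ge0 ?divr_ge0 ?mulr_ge0 ?expR_ge0.
  + rewrite in_itv => /andP[t0 tp].
    exact: exp_sum_bound_small.
- apply: int_pos => // [|t].
  + apply: measurable_funM; first exact: measurable_expRN_mulr.
    apply: measurableT_comp => //; apply: measurable_funN.
    apply: measurable_funM => //; apply: measurable_funV_pos.
      exact: measurable_funM.
    move=> t; rewrite /= in_itv => /andP[/(lt_trans p0) t0 _].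
    by rewrite !mulr_gt0.
  + rewrite in_itv => /andP[tp _].
    exact: exp_sum_bound_mid.
- rewrite -[leRHS]mul1e; apply: int_pos => //; first exact: measurable_expRN_mulr.
  move=> t; rewrite in_itv andbT => qt; rewrite mul1r.
  apply: exp_sum_trivial_bound => //.
  exact/ltW/(lt_trans _ qt)/(lt_le_trans p0 pq).
Qed.

(** The case [C = q = 0] of [expR_sum_bound]; it settles infinite distance. *)
Lemma exp_sum_eq0 (I : finType) (r lam : I -> R) (t : R) :
  (forall l, \sum_k r k * lam k ^+ l = 0) ->
  \sum_k r k * expR (- (t * lam k)) = 0.
Proof.
move=> H; apply/eqP; rewrite -normr_le0.
have := @expR_sum_bound R I r (fun k => - t * lam k) 0 0 (lexx 0).
rewrite mul0r; under eq_bigr do rewrite mulNr; apply=> n.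
under eq_bigr do rewrite exprMn mulrCA.
by rewrite -mulr_sumr H mulr0 normr0 mul0r.
Qed.

End LevyIntegral.

(** * Matrix entries as real sums over the spectrum *)

Section ComplexNumbers.
Variable R : realType.
Implicit Types z w : R[i].

Lemma normc_norm z : (normc z)%:C = `|z|.
Proof. by case: z => x y; rewrite normc_def. Qed.

Lemma Re_sum (I : finType) (F : I -> R[i]) :
  complex.Re (\sum_k F k) = \sum_k complex.Re (F k).
Proof. by apply: (big_morph (@complex.Re R)) => // -[? ?] [? ?]. Qed.

Lemma Re_mul_real z (x : R) : complex.Re (z * x%:C) = complex.Re z * x.
Proof. by case: z => u v /=; rewrite mulr0 subr0. Qed.

Lemma phase_exists z :
  exists2 w, normc w = 1 & complex.Re (w * z) = normc z.
Proof.
have [->|z0] := eqVneq z 0.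
  by exists 1; rewrite ?Normc.normc1 // mul1r Normc.normc0.
exists (z^* / `|z|).
  by apply: complexI; rewrite normc_norm normrM normfV norm_conjC normr_id divff ?normr_eq0.
rewrite mulrAC mulrC (mulrC _ z) -normCK expr2 mulrA mulVf ?normr_eq0 // mul1r.
by rewrite -normc_norm.
Qed.

Lemma Re_le_normc z : `|complex.Re z| <= normc z.
Proof. by have := normc_ge_Re z; rewrite -normc_norm lecR. Qed.

End ComplexNumbers.

(** * Walks and geodesic distance *)

Section Walks.
Variables (T : finType) (e : rel T).

Lemma has_walk0 (i : T) : has_walk e i i 0.
Proof. by apply/existsP; exists [tuple]; rewrite /= eqxx. Qed.

Lemma has_walk_rcons (i j l : T) (k : nat) :
  has_walk e i j k -> e j l -> has_walk e i l k.+1.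
Proof.
move=> /existsP[p /andP[pth /eqP lst]] ejl; apply/existsP; exists [tuple of rcons p l].
by rewrite /= rcons_path last_rcons pth lst ejl eqxx.
Qed.

Lemma geodist_le (i j : T) (k : nat) :
  has_walk e i j k -> exists2 d, geodist e i j = Some d & (d <= k)%N.
Proof.
move=> h; rewrite /geodist; case: pselect => [ex|[]]; last by exists k.
by exists (ex_minn ex) => //; case: ex_minnP => d _; apply.
Qed.

(** The edge is a nonzero off-diagonal entry, which will exclude a scalar [A] and hence
    [rho = 0]. *)
Lemma geodist_gt0 (i j : T) (d : nat) :
  geodist e i j = Some d -> (0 < d)%N -> exists l, e i l.
Proof.
rewrite /geodist; case: pselect => // ex [<-].
case: ex_minnP => -[//|m] /existsP[[[|l p] //= sp]] /andP[/andP[eil _] _] _ _.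
by exists l.
Qed.

End Walks.

(** * Spectral moments and weights of a normal matrix *)

Section Spectrum.
Variables (R : realType) (n : nat) (A : 'M[R[i]]_n).
Hypothesis A_normal : A \is normalmx.
Let P := spectralmx A.
Let D := spectral_diag A.

Lemma spectral_mulmx : P *m A = diag_mx D *m P.
Proof.
have /orthomx_spectralP AE := A_normal.
rewrite [in LHS]AE !mulmxA mulmxV ?mul1mx //; exact: spectral_unit.
Qed.

Lemma spectral_tC_mul : P ^t* *m P = 1%:M.
Proof. by apply: mulmx1C; apply/unitarymxP; exact: spectral_unitarymx. Qed.

Lemma spectral_eigenvalue (k : 'I_n) : eigenvalue A (D 0 k).
Proof.
(* [eigenvalue] refers to row eigenvectors, and [P A = D P] makes the rows of [P] such vectors. *)
apply/eigenvalueP; exists (row k P).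
  by rewrite -row_mul spectral_mulmx; apply/rowP => j; rewrite mul_diag_mx !mxE.
apply/eqP => /(congr1 (fun u => u *m invmx P)) /rowP/(_ k).
rewrite -row_mul mulmxV ?spectral_unit // mul0mx !mxE eqxx => /eqP.
by rewrite oner_eq0.
Qed.

(** The entry [(A^l)_ij], read off [A^l = P^H D^l P]. *)
Definition spectral_moment (i j : 'I_n) (l : nat) : R[i] :=
  \sum_k (P k i)^* * P k j * D 0 k ^+ l.

Lemma spectral_moment0 (i j : 'I_n) : spectral_moment i j 0 = (i == j)%:R.
Proof.
have /matrixP/(_ i j) := spectral_tC_mul; rewrite !mxE => <-.
by apply: eq_bigr => k _; rewrite !mxE mulr1.
Qed.

Lemma spectral_momentS (i j : 'I_n) (l : nat) :
  spectral_moment i j l.+1 = \sum_m spectral_moment i m l * A m j.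
Proof.
rewrite /spectral_moment; under [RHS]eq_bigr do rewrite mulr_suml.
rewrite exchange_big /=; apply: eq_bigr => k _.
have /matrixP/(_ k j) := spectral_mulmx; rewrite mul_diag_mx !mxE => E.
transitivity ((P k i)^* * D 0 k ^+ l * (D 0 k * P k j)); first by rewrite exprS; ring.
by rewrite -E mulr_sumr; apply: eq_bigr => m _; ring.
Qed.

Lemma spectral_moment1 (i j : 'I_n) : spectral_moment i j 1 = A i j.
Proof.
rewrite spectral_momentS (bigD1 i) //= spectral_moment0 eqxx mul1r big1 ?addr0 // => m mi.
by rewrite spectral_moment0 eq_sym (negPf mi) mul0r.
Qed.

(** In [A^(l+1) = A^l A] an off-diagonal factor extends the walk by an edge, while a diagonal one
    stays in place; so the walk may be shorter than [l]. *)
Lemma spectral_moment_walk (i j : 'I_n) (l : nat) :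
  spectral_moment i j l != 0 -> exists2 k, (k <= l)%N & has_walk (mxgraph A) i j k.
Proof.
elim: l j => [j|l IH j].
  rewrite spectral_moment0; have [<- _|_] := eqVneq i j; last by rewrite eqxx.
  by exists 0%N => //; exact: has_walk0.
rewrite spectral_momentS => nz.
have /existsP[m] : [exists m, spectral_moment i m l * A m j != 0].
  apply: contraNT nz; rewrite negb_exists => /forallP h.
  by apply/eqP/big1 => m _; apply/eqP; rewrite -[_ == _]negbK.
rewrite mulf_eq0 negb_or => /andP[/IH[k kl wk] Amj].
have [<-|mj] := eqVneq m j; first by exists k => //; exact: leqW.
by exists k.+1 => //; apply: has_walk_rcons wk _; rewrite /mxgraph /= mj.
Qed.

(** The columns of the unitary [P] have norm one; [x y <= (x^2 + y^2) / 2] is applied termwise. *)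
Lemma spectral_weights (i j : 'I_n) :
  \sum_k normc ((P k i)^* * P k j) <= 1.
Proof.
have E (m : 'I_n) : \sum_k normc (P k m) ^+ 2 = 1.
  apply: complexI; rewrite rmorph_sum /=.
  rewrite [RHS]rmorph1; have := spectral_moment0 m m; rewrite eqxx mulr1n => <-.
  apply: eq_bigr => k _.
  by rewrite rmorphXn /= normc_norm normCK mulr1 mulrC.
have -> : (1 : R) = (\sum_k normc (P k i) ^+ 2 + \sum_k normc (P k j) ^+ 2) / 2.
  by rewrite !E; lra.
rewrite -big_split /= mulr_suml; apply: ler_sum => k _.
have -> : normc ((P k i)^* * P k j) = normc (P k i) * normc (P k j).
  by apply: complexI; rewrite rmorphM /= !normc_norm normrM norm_conjC.
by have := sqr_ge0 (normc (P k i) - normc (P k j)); lra.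
Qed.

Lemma hermfun_entry (f : R -> R) (i j : 'I_n) :
  hermfun f A i j = \sum_k (P k i)^* * P k j * (f (complex.Re (D 0 k)))%:C.
Proof.
rewrite /hermfun -mulmxA mul_diag_mx !mxE; apply: eq_bigr => k _.
by rewrite !mxE -mulrA [X in _ * X]mulrC.
Qed.

(** The phase depends on [f] but not on [k], so it factors out of every moment; real eigenvalues
    commute with taking real parts. *)
Lemma hermfun_real_weights (i j : 'I_n) (f : R -> R) :
  exists r : 'I_n -> R,
    [/\ \sum_k `|r k| <= 1,
        normc (hermfun f A i j) = \sum_k r k * f (complex.Re (D 0 k)) &
        forall l, (forall k, D 0 k = (complex.Re (D 0 k))%:C) ->
          spectral_moment i j l = 0 ->
          \sum_k r k * complex.Re (D 0 k) ^+ l = 0].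
Proof.
have [w w1 wE] := phase_exists (hermfun f A i j).
exists (fun k => complex.Re (w * ((P k i)^* * P k j))); split.
- apply: le_trans (spectral_weights i j); apply: ler_sum => k _.
  by apply: le_trans (Re_le_normc _) _; rewrite Normc.normcM w1 mul1r.
- rewrite -wE hermfun_entry mulr_sumr Re_sum; apply: eq_bigr => k _.
  by rewrite mulrA Re_mul_real.
- move=> l Dre M0; under eq_bigr do rewrite -Re_mul_real.
  rewrite -Re_sum; transitivity (complex.Re (w * spectral_moment i j l)); last first.
    by rewrite M0 mulr0.
  rewrite mulr_sumr; congr complex.Re; apply: eq_bigr => k _.
  by rewrite rmorphXn /= -Dre; exact/esym/mulrA.
Qed.

End Spectrum.

(** For a row eigenvector [u], [u A u^H = x (u u^H)], where the left side is positive and [u u^H]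
    nonnegative. *)
Lemma posdef_eigenvalue_gt0 (R : realType) (n : nat) (A : 'M[R[i]]_n) (x : R[i]) :
  posdefmx A -> eigenvalue A x -> 0 < x.
Proof.
move=> [_ Apos] /eigenvalueP[u uA u0].
have vE : (u ^t*) ^t* = u by rewrite trmxCK.
have v0 : u ^t* != 0.
  by apply: contraNneq u0 => v0; rewrite -vE v0 !raddf0.
have := Apos _ v0; rewrite vE uA -scalemxAl mxE.
have uu : 0 <= (u *m u ^t*) ord0 ord0.
  by rewrite mxE sumr_ge0 // => k _; rewrite !mxE mul_conjC_ge0.
move=> xu; have c0 : 0 < (u *m u ^t*) ord0 ord0.
  by rewrite lt_neqAle uu andbT eq_sym; apply: contraTneq xu => ->; rewrite mulr0 ltxx.
by rewrite -(pmulr_lgt0 _ c0).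
Qed.

(* At d(i,j) = oo the right-hand side is 0: the first integrand vanishes and
   the last two ranges of integration are empty. *)
Theorem lemma3p6 (R : realType) (f : R -> R) (a b : R)
    (mu : {measure set (measurableTypeR R) -> \bar R})
    (n : nat) (A : 'M[R[i]]_n) (lmin lmax : R)
    (f_bernstein : bernstein f)
    (f_repr : levy_khintchine f a b mu)
    (A_posdef : posdefmx A)
    (lminP : smallest_eigenvalue A lmin)
    (lmaxP : largest_eigenvalue A lmax) :
  let rho := (lmax - lmin) / 4 in
  forall i j : 'I_n,
    dist_geq 2 (geodist (mxgraph A) i j) ->
    ((normc (hermfun f A i j))%:E <=
      if geodist (mxgraph A) i j is Some d then
        10%:E * \int[mu]_(t in `]0%R, (d%:R / (2 * rho))%R])
           (expR (- ((rho + lmin) * t)) / (rho * t) *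
              (expR 1 * rho * t / d%:R) ^+ d)%:E
        + 10%:E * \int[mu]_(t in `](d%:R / (2 * rho))%R, (d%:R ^+ 2 / (4 * rho))%R])
           (expR (- (t * lmin)) * expR (- (d%:R ^+ 2 / (5 * rho * t))))%:E
        + \int[mu]_(t in `](d%:R ^+ 2 / (4 * rho))%R, +oo[)
           (expR (- (t * lmin)))%:E
      else 0)%E.

Proof.
move=> rho i j dist2.
have A_normal : A \is normalmx by apply: hermitian_normalmx; case: A_posdef.
case: lminP => lmin_eig lmin_le; case: lmaxP => _ lmax_ge.
have lmin0 : 0 < lmin by have := posdef_eigenvalue_gt0 A_posdef lmin_eig; rewrite ltcR.
pose lam k := complex.Re (spectral_diag A 0 k).
have eig k := spectral_eigenvalue A_normal k.
have lamE k : spectral_diag A 0 k = (lam k)%:C.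
  (* Comparability with the real [lmin] forces the imaginary part to vanish. *)
  have := lmin_le _ (eig k); rewrite lecE /= => /andP[/eqP im _].
  by rewrite /lam; case: (spectral_diag A 0 k) im => x y /= ->.
have lamb k : lmin <= lam k <= lmin + 4 * rho.
  have -> : lmin + 4 * rho = lmax by rewrite /rho; field.
  by have := lmin_le _ (eig k); have := lmax_ge _ (eig k); rewrite lamE !lecR => -> ->.
have [r [r1 -> rM]] := hermfun_real_weights A i j f.
(* A nonzero moment of order [l < d] would give a walk of length at most [l], hence a distance below
   [d]. *)
have M0 d : dist_geq d (geodist (mxgraph A) i j) ->
    forall l, (l < d)%N -> \sum_k r k * lam k ^+ l = 0.
  move=> dist_d l ld; apply: rM lamE _; apply: contraTeq dist_d.
  move=> /(spectral_moment_walk A_normal)[k kl /geodist_le[m -> mk]] /=.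
  by rewrite -ltnNge (leq_ltn_trans mk) // (leq_ltn_trans kl).
case E : (geodist (mxgraph A) i j) => [d|]; last first.
  have rM0 l : \sum_k r k * lam k ^+ l = 0 by apply: (M0 l.+1) => //; rewrite E.
  apply: le_trans (levy_sum_le f_repr _ _ _) _.
  - by move=> k; apply: lt_le_trans lmin0 _; case/andP: (lamb k).
  - by have := rM0 0%N; under eq_bigr do rewrite expr0 mulr1.
  - by have := rM0 1%N; under eq_bigr do rewrite expr1.
  by rewrite integral0_eq // => t _; rewrite exp_sum_eq0 // normr0.
have d2 : (2 <= d)%N by move: dist2; rewrite E.
have {}M0 : forall l, (l < d)%N -> \sum_k r k * lam k ^+ l = 0.
  by apply: M0; rewrite E /=.
(* If [rho = 0], all eigenvalues equal [lmin] and [A] is scalar; but [i] has an edge, its distance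
   to [j] being finite and positive. *)
have rho0 : 0 < rho.
  rewrite lt_neqAle eq_sym; apply/andP; split; last first.
    have [k] : exists k : 'I_n, true by exists i.
    by have := lamb k; lra.
  apply/eqP => rho0.
  have [l /andP[il]] := geodist_gt0 E (ltnW d2).
  have lamc k : lam k = lmin by have := lamb k; rewrite rho0; lra.
  rewrite -(spectral_moment1 A_normal) /spectral_moment.
  under eq_bigr do rewrite lamE lamc mulrC.
  rewrite -mulr_sumr; have := spectral_moment0 A i l; rewrite /spectral_moment.
  under eq_bigr do rewrite expr0 mulr1.
  by move=> ->; rewrite (negPf il) mulr0 eqxx.
exact: levy_sum_bound f_repr lmin0 rho0 d2 r1 lamb M0.
Qed.
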